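(* Let $X$ be a connected non-bipartite graph. If the first homology group $H_1(\mathcal N(X))$ of its neighborhood complex is torsion (every element has finite order), then $\chi(X)\geq 4$.
   Context: The neighborhood complex $\mathcal N(X)$ of a graph $X$ is the simplicial complex with vertex set $V(X)$ whose faces are exactly those sets $W\subseteq V(X)$ whose elements have a common neighbor in $X$. $H_1$ denotes the first (integral) singular/simplicial homology group of (the geometric realization of) this complex, and $\chi(X)$ is the chromatic number of $X$. *)

(* Defs.v *)
From HB Require Import structures.
From mathcomp Require Import all_boot all_order all_algebra.
From mathcomp Require Import finmap boolp monalg zify.

Set Implicit Arguments.
Unset Strict Implicit.
Unset Printing Implicit Defensive.

Import GRing.Theory.

Local Open Scope ring_scope.
Local Open Scope fset_scope.

(* Simple undirected graphs; the vertex set may be infinite. *)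
Record graph := Graph {
  vertex :> choiceType;
  adj : rel vertex;
  adj_sym : symmetric adj;
  adj_irrefl : irreflexive adj }.

Definition connected (X : graph) : Prop :=
  forall x y : X, exists2 p : seq X, path (@adj X) x p & last x p = y.

Definition bipartite (X : graph) : Prop :=
  exists side : X -> bool, forall x y : X, adj x y -> side x != side y.

Definition colorable (X : graph) (k : nat) : Prop :=
  exists f : X -> 'I_k, forall x y : X, adj x y -> f x != f y.

(* [None] stands for an infinite chromatic number. *)
Definition chromatic_number (X : graph) : option nat :=
  if pselect (exists k, `[< colorable X k >]) is left h
  then Some (ex_minn h) else None.

Definition le_chromatic (k : nat) (chi : option nat) : Prop :=
  if chi is Some m then (k <= m)%N else True.

Record simplicial_complex (V : choiceType) := SimplicialComplex {
  face :> {fset V} -> Prop;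
  face_sub : forall A B : {fset V}, A `<=` B -> face B -> face A }.

Section Homology.
Variable V : choiceType.
Implicit Type K : simplicial_complex V.

(* Homology is computed with the ordered chain complex: C_n(K) is the free
   abelian group on the (n+1)-tuples of vertices, repetitions allowed, whose
   underlying set is a face of K, and
     bd (v_0, ..., v_n) = \sum_i (-1)^i (v_0, .., v_{i-1}, v_{i+1}, .., v_n).
   No total order or orientation has to be chosen on the vertices. *)
Definition chain n := {malg int[n.+1.-tuple V]}.

Definition omit n (i : 'I_n.+2) (s : n.+2.-tuple V) : n.+1.-tuple V :=
  [tuple tnth s (lift i j) | j < n.+1].

Definition bd n (c : chain n.+1) : chain n :=
  \sum_(s <- msupp c) \sum_(i < n.+2) << (-1) ^+ i * c@_s *g omit i s >>.

(* The complex is not augmented: every 0-chain is closed. *)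
Definition closed_chain n : chain n -> bool :=
  if n is m.+1 then fun c => bd c == 0 else fun=> true.

Definition chain_on K n (c : chain n) : Prop :=
  forall s, s \in msupp c -> K [fset x | x in tval s].

Lemma bdEw n (c : chain n.+1) (D : {fset n.+2.-tuple V}) : msupp c `<=` D ->
  bd c = \sum_(s <- D) \sum_(i < n.+2) << (-1) ^+ i * c@_s *g omit i s >>.
Proof.
move=> cD; rewrite /bd (big_fset_incl _ cD) // => s _ /mcoeff_outdom ->.
by apply: big1 => i _; rewrite mulr0 monalgU0.
Qed.

Fact bd_is_zmod_morphism n : zmod_morphism (@bd n).
Proof.
move=> c d; have cdD := @msuppB_le _ _ c d.
rewrite (bdEw cdD) (bdEw (fsubsetUl _ (msupp d))).
rewrite (bdEw (fsubsetUr (msupp c) _)) -sumrB.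
apply: eq_bigr => s _; rewrite -sumrB; apply: eq_bigr => i _.
by rewrite mcoeffB mulrBr monalgUB.
Qed.

HB.instance Definition _ n :=
  GRing.isZmodMorphism.Build (chain n.+1) (chain n) (@bd n)
    (@bd_is_zmod_morphism n).

Lemma bdU n (z : int) (s : n.+2.-tuple V) :
  bd << z *g s >> = \sum_(i < n.+2) << (-1) ^+ i * z *g omit i s >>.
Proof. by rewrite (bdEw msuppU_le) big_seq_fset1 mcoeffUU. Qed.

Lemma chain_on0 K n : chain_on K (0 : chain n).
Proof. by move=> s; rewrite msupp0 inE. Qed.

Lemma chain_onB K n (c d : chain n) :
  chain_on K c -> chain_on K d -> chain_on K (c - d).
Proof.
move=> hc hd s /(fsubsetP (msuppB_le _ _)).
by rewrite in_fsetU => /orP[/hc|/hd].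
Qed.

Lemma chain_on_bd K n (c : chain n.+1) : chain_on K c -> chain_on K (bd c).
Proof.
move=> hc t; rewrite -mcoeff_neq0 /bd raddf_sum /= => nz.
have [s sc [i ti]] : exists2 s, s \in msupp c & exists i, t = omit i s.
  apply: contrapT => h; case/eqP: nz.
  rewrite big_seq big1 // => s sc; rewrite raddf_sum big1 //= => i _.
  rewrite mcoeffU; case: eqP => [e|_]; last by rewrite mulr0n.
  by case: h; exists s => //; exists i.
apply: (face_sub _ (hc s sc)); apply/fsubsetP => x; rewrite !inE ti.
by case/mapP => j _ ->; exact: mem_tnth.
Qed.

Lemma bd_bd n (c : chain n.+2) : bd (bd c) = 0.
Proof.
rewrite (monalgE c) (raddf_sum (@bd n.+1)) (raddf_sum (@bd n)) big1 // => s _ /=.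
move: c@_s => z; rewrite bdU raddf_sum /=; under eq_bigr do rewrite bdU.
rewrite pair_bigA /=.
pose h (p : 'I_n.+3 * 'I_n.+2) : 'I_n.+3 * 'I_n.+2 :=
  if (p.2 < p.1)%N then (inord p.2, inord p.1.-1) else (inord p.2.+1, inord p.1).
have hK : involutive h.
  move=> [[i hi] [j hj]]; rewrite /h /=; case: (ltnP j i) => ij /=.
    rewrite !inordK; try lia.
    have -> : (i.-1 < j)%N = false by lia.
    congr pair; apply: val_inj; rewrite /= inordK; lia.
  rewrite !inordK; try lia.
  have -> : (i < j.+1)%N by lia.
  congr pair; apply: val_inj; rewrite /= inordK; lia.
set S := (LHS).
suff SN : S = - S.
  apply/malgP => k; rewrite mcoeff0; move/malgP/(_ k): SN; rewrite mcoeffN; lia.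
rewrite {1}/S (reindex_inj (inv_inj hK)) /= /S -sumrN.
apply: eq_bigr => -[[i hi] [j hj]] _.
have -> : omit (h (Ordinal hi, Ordinal hj)).2
    (omit (h (Ordinal hi, Ordinal hj)).1 s) =
  omit (Ordinal hj) (omit (Ordinal hi) s).
  apply: eq_from_tnth => k; rewrite !tnth_mktuple; congr tnth.
  apply: val_inj; rewrite /h /=; case: (ltnP j i) => ij /=.
    rewrite !inordK /bump; lia.
  rewrite !inordK /bump; lia.
rewrite -monalgUN; congr mkmalgU.
rewrite !mulrA -!exprD -mulNr; congr (_ * z).
rewrite /h /=; case: (ltnP j i) => ij /=; rewrite !inordK; try lia.
  have -> : (j + i = (i.-1 + j).+1)%N by lia.
  by rewrite exprS mulN1r opprK.
by rewrite addnS exprS mulN1r addnC.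
Qed.

Definition cycles K n : {pred chain n} :=
  fun c => `[< chain_on K c >] && closed_chain c.

Lemma closed_chain0 n : closed_chain (0 : chain n).
Proof. by case: n => [|n] //; rewrite /closed_chain raddf0. Qed.

Lemma closed_chainB n (c d : chain n) :
  closed_chain c -> closed_chain d -> closed_chain (c - d).
Proof.
case: n c d => [//|n] c d; rewrite /closed_chain => /eqP zc /eqP zd.
by rewrite raddfB /= zc zd subrr.
Qed.

Fact cycles_zmod_closed K n : zmod_closed (@cycles K n).
Proof.
split=> [|c d].
  by apply/andP; split; [exact/asboolP/chain_on0 | exact: closed_chain0].
move=> /andP[/asboolP hc zc] /andP[/asboolP hd zd].
by apply/andP; split; [exact/asboolP/chain_onB | exact: closed_chainB].
Qed.

HB.instance Definition _ K n :=
  GRing.isZmodClosed.Build (chain n) (@cycles K n) (@cycles_zmod_closed K n).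

Record cycle K n := Cycle {
  cycle_val :> chain n;
  cycleP : cycle_val \in @cycles K n }.

HB.instance Definition _ K n := [isSub for @cycle_val K n].
HB.instance Definition _ K n := [Choice of cycle K n by <:].
HB.instance Definition _ K n := [SubChoice_isSubZmodule of cycle K n by <:].

Definition boundaries K n : {pred cycle K n} :=
  fun z => `[< exists2 d : chain n.+1, chain_on K d & bd d = z >].

Fact boundaries_zmod_closed K n : zmod_closed (@boundaries K n).
Proof.
split=> [|y z].
  rewrite unfold_in; apply/asboolP; exists 0; first exact: chain_on0.
  by rewrite raddf0.
rewrite !unfold_in => /asboolP[c hc yE] /asboolP[d hd zE].
apply/asboolP; exists (c - d); first exact: chain_onB.
by rewrite raddfB /= yE zE.
Qed.

HB.instance Definition _ K n :=
  GRing.isZmodClosed.Build (cycle K n) (@boundaries K n)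
    (@boundaries_zmod_closed K n).

(* [boundaries K n] is a predicate on cycles; [bd_bd] and [chain_on_bd] say that
   it contains the boundary of every chain of K. *)
Definition homology K n := Quotient.quot (@boundaries K n).

HB.instance Definition _ K n := GRing.Zmodule.on (homology K n).

End Homology.

Definition torsion (G : zmodType) : Prop :=
  forall g : G, exists2 m : nat, (0 < m)%N & g *+ m = 0.

Section Neighborhood.
Variable X : graph.

Definition common_neighbor (W : {fset X}) : Prop :=
  exists v : X, forall w, w \in W -> adj w v.

Fact common_neighbor_sub (A B : {fset X}) :
  A `<=` B -> common_neighbor B -> common_neighbor A.
Proof. by move=> /fsubsetP sAB [v hv]; exists v => w /sAB/hv. Qed.

Definition neighborhood_complex : simplicial_complex X :=
  SimplicialComplex common_neighbor_sub.

End Neighborhood.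

(* Main.v *)
Require Import Defs.
From mathcomp Require Import all_boot all_algebra.
From mathcomp Require Import finmap boolp monalg zify.

Set Implicit Arguments.
Unset Strict Implicit.
Unset Printing Implicit Defensive.

Import GRing.Theory Num.Theory.

Local Open Scope ring_scope.

(** Let [f] be a 3-colouring of [X].  The difference [f y - f x], lifted from
    Z/3 to {-1, 0, 1}, is a 1-cocycle on the neighbourhood complex, because the
    vertices of a face avoid the colour of their common neighbour and so carry
    at most two colours.  Traversing an odd closed walk of [X] twice in steps of
    two gives a 1-cycle.  The cocycle takes on it the opposite of the sum of the
    lifted differences along the walk; this is an odd number of signs, hence
    nonzero, so the class of the cycle has infinite order. *)

Definition color_diff (a b : 'I_3) : int :=
  match ((b + 3 - a) %% 3)%N with 0%N => 0 | 1%N => 1 | _ => -1 end.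

(** Avoiding [v] forces two of the three colours to coincide, and [color_diff] is antisymmetric;
    three distinct colours would give 3 or -3. *)
Lemma color_diff_cocycle (v a b c : 'I_3) : a != v -> b != v -> c != v ->
  color_diff b c - color_diff a c + color_diff a b = 0.
Proof.
by case: v a b c => [[|[|[|//]]] ?] [[|[|[|//]]] ?] [[|[|[|//]]] ?]
  [[|[|[|//]]] ?].
Qed.

(* The sum of two signs is -2, 0 or 2, and the lift of [2] from Z/3 is [-1]. *)
Lemma color_diff_two_steps (v a b : 'I_3) : a != v -> b != v ->
  color_diff a v + color_diff v b = - (color_diff a b *+ 2).
Proof.
by case: v a b => [[|[|[|//]]] ?] [[|[|[|//]]] ?] [[|[|[|//]]] ?].
Qed.

Lemma color_diff_sign (a b : 'I_3) : a != b ->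
  color_diff a b = 1 \/ color_diff a b = -1.
Proof.
by case: a b => [[|[|[|//]]] ?] [[|[|[|//]]] ?]; do ?[by left | by right].
Qed.

Section Walks.
Variable X : graph.
Implicit Types (x y : X) (p q : seq X).

(** Otherwise the ends of even walks from [x0] would form one side of a bipartition. *)
Lemma odd_closed_walk x0 : connected X -> ~ bipartite X ->
  exists p, [/\ path (@adj X) x0 p, last x0 p = x0 & odd (size p)].
Proof.
move=> conn nbip; apply: contrapT => noodd; apply: nbip.
pose even_walk x := exists p,
  [/\ path (@adj X) x0 p, last x0 p = x & ~~ odd (size p)].
exists (fun x => `[< even_walk x >]) => x y xy.
apply/negP => /eqP sxy; have [[p [pp px ep]]|nx] := pselect (even_walk x).
  have : `[< even_walk y >] by rewrite -sxy; apply/asboolP; exists p.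
  case/asboolP => q [pq qy eq]; apply: noodd.
  (* Follow [p] to [x], cross to [y] and return along [q] reversed: even + 1 + even. *)
  exists (p ++ y :: rev (belast x0 q)); split.
  - rewrite cat_path pp px /= xy -qy rev_path /=.
    by rewrite (eq_path (e' := @adj X)) // => u v; rewrite adj_sym.
  - rewrite last_cat /=; case: (q) qy => [|z q'] /=; first by move->.
    by rewrite rev_cons last_rcons.
  - by rewrite size_cat /= size_rev size_belast; lia.
(* Only odd walks reach [x]; the edge to [y] makes one even, and [sxy] carries this back to [x]. *)
have [p pp px] := conn x0 x.
have op : odd (size p) by apply/negPn/negP => ep; apply: nx; exists p.
apply: nx; apply/asboolP; rewrite sxy; apply/asboolP.
exists (rcons p y); split; last by rewrite size_rcons /= op.
- by rewrite rcons_path pp px.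
- by rewrite last_rcons.
Qed.

(** On a walk, the skipped vertex is a common neighbour of [x] and [b], which makes them a face. An
    unpaired last step is dropped. *)
Fixpoint two_step_chain x p : chain X 1 :=
  if p is _ :: b :: q then << [tuple x; b] >> + two_step_chain b q else 0.

Lemma two_step_ind (P : X -> seq X -> Prop) :
  (forall x, P x [::]) -> (forall x a, P x [:: a]) ->
  (forall x a b q, P b q -> P x [:: a, b & q]) -> forall x p, P x p.
Proof.
move=> P0 P1 PS x p.
(* List induction advances one step at a time, so the claim for one-step extensions is carried
   along. *)
suff : P x p /\ forall a, P x (a :: p) by case.
elim: p x => [|b p IH] x; first by [].
by split=> [|a]; [exact: (IH x).2 | apply: PS; exact: (IH b).1].
Qed.

(** The boundaries telescope; even length ensures that no last step is lost. *)
Lemma bd_two_step_chain x p : ~~ odd (size p) ->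
  bd (two_step_chain x p) = << [tuple last x p] >> - << [tuple x] >>.
Proof.
elim/two_step_ind: x / p => [x _|x a //|x a b q IH] /=; first by rewrite raddf0 subrr.
rewrite negbK => oq; rewrite raddfD /= IH //.
rewrite bdU !big_ord_recl big_ord0 /= addr0.
have -> : omit ord0 [tuple x; b] = [tuple b].
  by apply: eq_from_tnth => i; rewrite tnth_mktuple [i]ord1 !(tnth_nth x).
have -> : omit (lift ord0 ord0) [tuple x; b] = [tuple x].
  by apply: eq_from_tnth => i; rewrite tnth_mktuple [i]ord1 !(tnth_nth x).
rewrite expr0 expr1 !mulr1 monalgUN.
by rewrite [LHS]addrC addrA subrK.
Qed.

Lemma two_step_chain_on x p : path (@adj X) x p ->
  chain_on (neighborhood_complex X) (two_step_chain x p).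
Proof.
elim/two_step_ind: x / p => [x _|x a _|x a b q IH] /=; try exact: chain_on0.
case/and3P=> xa ab /IH h s /(fsubsetP (msuppD_le _ _)).
rewrite in_fsetU => /orP[/(fsubsetP msuppU_le)|/h //].
rewrite in_fset1 => /eqP ->; exists a => w; rewrite !inE.
by rewrite orbF => /orP[]/eqP -> //; rewrite adj_sym.
Qed.

Variable f : X -> 'I_3.
Hypothesis f_proper : forall x y, adj x y -> f x != f y.

Definition diff_cochain (s : 2.-tuple X) : int :=
  color_diff (f (tnth s ord0)) (f (tnth s ord_max)).

Definition eval_diff : chain X 1 -> int := mmap idfun diff_cochain.

Lemma eval_diffU z s : eval_diff << z *g s >> = z * diff_cochain s.
Proof. by rewrite /eval_diff mmapU. Qed.

Lemma eval_diffD : {morph eval_diff : c d / c + d}.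
Proof. exact: mmapD. Qed.

Lemma eval_diffMn n : {morph eval_diff : c / c *+ n}.
Proof. exact: mmapMn. Qed.

Lemma eval_diff_bd (d : chain X 2) :
  chain_on (neighborhood_complex X) d -> eval_diff (bd d) = 0.
Proof.
move=> dN; rewrite /eval_diff /bd raddf_sum big_seq big1 //= => s /dN [v sv].
rewrite raddf_sum /=.
under eq_bigr do rewrite -/(eval_diff _) eval_diffU.
(* The common neighbour [v] supplies the avoided colour; it is also the default of [nth]. *)
have fv i : (i < 3)%N -> f (nth v s i) != f v.
  by move=> i3; apply: f_proper; apply: sv; rewrite !inE mem_nth ?size_tuple.
rewrite !big_ord_recl big_ord0 /diff_cochain !tnth_mktuple !(tnth_nth v) /=.
rewrite expr0 expr1 expr2 mulrNN mulN1r !mul1r mulNr addr0 -mulrN -!mulrDr.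
by rewrite addrA (color_diff_cocycle (fv 0%N _) (fv 1%N _) (fv 2%N _)) ?mulr0.
Qed.

Fixpoint walk_diff x p : int :=
  if p is a :: q then color_diff (f x) (f a) + walk_diff a q else 0.

Lemma walk_diff_cat x p q :
  walk_diff x (p ++ q) = walk_diff x p + walk_diff (last x p) q.
Proof. by elim: p x => [|a p IH] x /=; rewrite ?add0r // IH addrA. Qed.

(** Each step adds 1 or -1 and so flips the parity. *)
Lemma odd_walk_diff x p : path (@adj X) x p ->
  odd `|walk_diff x p|%N = odd (size p).
Proof.
elim: p x => [//|a p IH] x /= /andP[xa /IH]; have := color_diff_sign (f_proper xa).
lia.
Qed.

Lemma eval_two_step_chain x p : path (@adj X) x p -> ~~ odd (size p) ->
  walk_diff x p = - (eval_diff (two_step_chain x p) *+ 2).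
Proof.
elim/two_step_ind: x / p => [x|x a //|x a b q IH] /=.
  by rewrite /eval_diff raddf0 mul0rn oppr0.
case/and3P=> xa ab pq; rewrite negbK => /(IH pq) ->.
rewrite addrA (color_diff_two_steps (f_proper xa)); last first.
  by apply: f_proper; rewrite adj_sym.
by rewrite -opprD -mulrnDl eval_diffD eval_diffU mul1r /diff_cochain !(tnth_nth x).
Qed.

End Walks.

Theorem theorem1p4 (X : graph) :
  connected X -> ~ bipartite X ->
  torsion (homology (neighborhood_complex X) 1) ->
  le_chromatic 4 (chromatic_number X).
Proof.
move=> conn nbip tors; rewrite /chromatic_number.
case: pselect => // h; case: ex_minnP => k /asboolP[f0 f0P] _ /=.
rewrite ltnNge; apply/negP => k3.
pose f x := widen_ord k3 (f0 x).
have fP x y : adj x y -> f x != f y by move/f0P; apply: contra => /eqP [] /val_inj ->.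
(* The empty graph counts as connected, but it is bipartite. *)
have [x0] : exists x0 : X, True.
  apply: contrapT => noX; apply: nbip; exists (fun=> true) => x.
  by case: noX; exists x.
move=> _; have [p [pp px op]] := odd_closed_walk x0 conn nbip.
have pp2 : path (@adj X) x0 (p ++ p) by rewrite cat_path px pp.
have ep2 : ~~ odd (size (p ++ p)) by rewrite size_cat; lia.
set z := two_step_chain x0 (p ++ p).
have zc : z \in @cycles _ (neighborhood_complex X) 1.
  apply/andP; split; first exact/asboolP/two_step_chain_on.
  by rewrite /closed_chain bd_two_step_chain // last_cat !px subrr.
have [m m0] := tors (\pi_(homology (neighborhood_complex X) 1) (Cycle zc))%qT.
rewrite -raddfMn -[X in _ = X](raddf0 \pi_(homology (neighborhood_complex X) 1)%qT).
(* [z *+ m] is the boundary of [d], so [eval_diff z *+ m = 0], and [m > 0] gives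
   [eval_diff z = 0]. *)
move/eqP; rewrite -Quotient.idealrBE subr0 unfold_in => /asboolP[d dN dE].
have := eval_diff_bd fP dN.
rewrite dE -[cycle_val _]/(\val _) raddfMn /= eval_diffMn => /eqP.
rewrite mulrn_eq0 eqn0Ngt m0 /= => /eqP z0.
(* Twice [walk_diff x0 p] is then 0, although [walk_diff x0 p] is odd. *)
have := eval_two_step_chain fP pp2 ep2; rewrite -/z z0 mul0rn oppr0.
rewrite walk_diff_cat px; have := odd_walk_diff fP pp; rewrite op; lia.
Qed.
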